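(* For any positive integer $v \equiv 1,3 \pmod 6$, we have \[ f(v) \leq \frac{2v+5-\sqrt{24v+25}}{2}. \]
   Context: A Steiner triple system of order $v$ (STS$(v)$) is a pair $(X,\mathcal{B})$ where $X$ is a set of $v$ points and $\mathcal{B}$ is a set of $3$-element subsets of $X$ (blocks) such that every pair of distinct points of $X$ is contained in exactly one block. For $Y \subseteq X$ and $\mathcal{C} \subseteq \mathcal{B}$, the pair $(Y,\mathcal{C})$ is a nonincident set of points and blocks if $y \notin B$ for all $y \in Y$ and all $B \in \mathcal{C}$. $f(v)$ denotes the maximum integer $s$ such that there exists a nonincident set of $s$ points and $s$ blocks in some STS$(v)$. *)

(* Defs.v *)
From mathcomp Require Import all_boot all_order all_algebra.

Set Implicit Arguments.
Unset Strict Implicit.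
Unset Printing Implicit Defensive.

(* The point set is the whole finite type T, and the order is #|T|. *)
Definition is_STS (T : finType) (B : {set {set T}}) : bool :=
  [forall b in B, #|b| == 3] &&
  [forall x, forall y, (x != y) ==>
     (#|[set b in B | (x \in b) && (y \in b)]| == 1)].

Definition nonincident (T : finType) (Y : {set T}) (C : {set {set T}}) : bool :=
  [forall y in Y, forall b in C, y \notin b].

(* Up to relabelling, the points of an STS(v) are the elements of 'I_v. *)
Definition has_nonincident (v s : nat) : bool :=
  [exists B : {set {set 'I_v}}, is_STS B &&
   [exists Y : {set 'I_v}, exists C : {set {set 'I_v}},
     [&& C \subset B, nonincident Y C, #|Y| == s & #|C| == s]]].

(* The range s <= v is no restriction, since s is the size of a set of points;
   lemmas [f_upper_bound] and [f_attained] show that this is the maximum over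
   all STS(v), on any point set. For v admitting no STS(v), f v = 0. *)
Definition f (v : nat) : nat := \max_(s < v.+1 | has_nonincident v s) s.

Lemma f_upper_bound (T : finType) (B C : {set {set T}}) (Y : {set T}) :
  is_STS B -> C \subset B -> nonincident Y C -> #|Y| = #|C| -> #|Y| <= f #|T|.
Proof.
move=> /andP[/forall_inP B3 /forallP Bp] sCB /forall_inP nYC eYC.
have ltY : #|Y| < #|T|.+1 by rewrite ltnS max_card.
pose g (x : T) : 'I_#|T| := enum_rank x.
have gI : injective g by exact: enum_rank_inj.
have gS : injective (fun b : {set T} => g @: b) by exact: imset_inj.
suff H : has_nonincident #|T| (Ordinal ltY).
  by apply: (leq_bigmax_cond (Ordinal ltY)).
apply/existsP; exists [set g @: b | b : {set T} in B]; apply/andP; split.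
  apply/andP; split.
    by apply/forall_inP=> _ /imsetP[b bB ->]; rewrite card_imset ?B3.
  apply/forallP=> i; apply/forallP=> j; apply/implyP=> nij.
  rewrite -(enum_valK i) -(enum_valK j) -/(g _) -/(g _).
  set x := enum_val i; set y := enum_val j.
  have nxy : x != y by rewrite (inj_eq enum_val_inj).
  have /forallP/(_ y)/implyP/(_ nxy)/eqP <- := Bp x.
  rewrite -(card_imset _ gS); apply/eqP/eq_card=> c; rewrite inE.
  apply/andP/imsetP=> [[/imsetP[b bB ->]]|[b]].
    by rewrite !(mem_imset _ _ gI) => xyb; exists b; rewrite // inE bB.
  by rewrite inE => /andP[bB xyb] ->; rewrite !(mem_imset _ _ gI) imset_f.
apply/existsP; exists (g @: Y); apply/existsP; exists [set g @: b | b : {set T} in C].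
rewrite imsetS // !card_imset //= -eYC !eqxx !andbT.
apply/forall_inP=> _ /imsetP[y yY ->]; apply/forall_inP=> _ /imsetP[b bC ->].
by rewrite (mem_imset _ _ gI); have /forall_inP -> := nYC y yY.
Qed.

Lemma f_attained (v : nat) (B : {set {set 'I_v}}) :
  is_STS B -> has_nonincident v (f v).
Proof.
move=> BS; have H0 : has_nonincident v (ord0 : 'I_v.+1).
  apply/existsP; exists B; rewrite BS.
  apply/existsP; exists set0; apply/existsP; exists set0.
  rewrite sub0set !cards0 !eqxx !andbT /=.
  by apply/forall_inP=> y; rewrite inE.
by rewrite /f (bigmax_eq_arg ord0) //; case: arg_maxnP.
Qed.

(* Main.v *)
Require Import Defs.
From mathcomp Require Import all_boot all_order all_algebra.
From mathcomp Require Import lra.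
Import Order.TTheory GRing.Theory Num.Theory.
Local Open Scope ring_scope.

(** The blocks of a nonincident pair (Y, C) lie in the complement of Y, and
    distinct blocks share no pair of points; so the 3 #|C| pairs covered by C
    are distinct pairs of points outside Y. With w = v - s this reads
    6 s <= w (w - 1), i.e. 24 v + 25 <= (2 w + 5) ^ 2. *)

Lemma STS_pair_blocks_le1 (T : finType) (B C : {set {set T}}) (A : {set T}) :
  is_STS B -> C \subset B -> #|A| = 2%N ->
  (#|[set b in C | A \subset b]| <= 1)%N.
Proof.
move=> /andP[_ /forallP Bp] sCB /eqP/cards2P[x [y [nxy ->]]].
have /forallP/(_ y)/implyP/(_ nxy)/eqP <- := Bp x.
apply/subset_leq_card/subsetP => b; rewrite !inE subUset !sub1set.
by case/andP=> /(subsetP sCB) -> ->.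
Qed.

Lemma nonincident_pairs_le (T : finType) (B C : {set {set T}}) (Y : {set T}) :
  is_STS B -> C \subset B -> nonincident Y C ->
  (3 * #|C| <= 'C(#|~: Y|, 2))%N.
Proof.
move=> BS sCB /forall_inP nYC.
have /andP[/forall_inP B3 _] := BS.
have sbY b : b \in C -> b \subset ~: Y.
  move=> bC; apply/subsetP => x xb; rewrite inE; apply/negP => xY.
  by have /forall_inP/(_ b bC) := nYC x xY; rewrite xb.
pose pairs (D : {set T}) := [set A : {set T} | A \subset D & #|A| == 2].
(* The 3 is the number of 2-subsets of a block, 'C(3, 2). *)
have -> : (3 * #|C| = \sum_(b in C) \sum_(A in pairs b) 1)%N.
  rewrite mulnC -sum_nat_const; apply: eq_bigr => b bC.
  by rewrite sum1_card cards_draws (eqP (B3 b (subsetP sCB b bC))).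
rewrite -cards_draws -sum1_card.
(* Summing over pairs first is legitimate because every pair inside a block of [C] avoids [Y]; each
   pair then contributes the number of blocks of [C] containing it, which is at most 1. *)
rewrite (exchange_big_dep (mem (pairs (~: Y)))) /=; last first.
  move=> b A bC; rewrite !inE => /andP[Ab ->].
  by rewrite (subset_trans Ab (sbY b bC)).
apply: leq_sum => A; rewrite inE => /andP[_ A2].
apply: leq_trans (STS_pair_blocks_le1 _ _ C A BS sCB (eqP A2)).
rewrite sum1dep_card; apply/subset_leq_card/subsetP => b.
by rewrite !inE A2 andbT.
Qed.

Lemma has_nonincident_le (v s : nat) :
  has_nonincident v s -> (6 * s <= (v - s) * (v - s).-1)%N.
Proof.
case/existsP=> B /andP[BS /existsP[Y /existsP[C]]].
case/and4P=> sCB nYC /eqP eY /eqP eC.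
have := nonincident_pairs_le _ B C Y BS sCB nYC.
rewrite [#|~: Y|]cardsCs setCK card_ord eY eC -(leq_pmul2r (isT : 0 < 2)%N).
(* Reading the factor 2 as a factorial lets [bin_ffact] turn the doubled binomial into the falling
   factorial w (w - 1). *)
by rewrite -[X in (_ <= _ * X)%N]/(2`!) bin_ffact ffactnSr ffactn1 subn1 mulnAC.
Qed.

Lemma f_le (v : nat) : (f v <= v)%N.
Proof. by apply/bigmax_leqP => s _; rewrite -ltnS. Qed.

(* Also covers the orders with no STS, where f v = 0. *)
Lemma f_pairs_le (v : nat) : (6 * f v <= (v - f v) * (v - f v).-1)%N.
Proof.
rewrite /f; elim/big_ind: _ => // [m n Hm Hn | s /has_nonincident_le //].
by rewrite /maxn; case: ifP.
Qed.

Theorem theorem3 (R : rcfType) (v : nat) (hv0 : (0 < v)%N)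
  (hv : (v = 1 %[mod 6])%N \/ (v = 3 %[mod 6])%N) :
  (f v)%:R <= (2 * v%:R + 5 - Num.sqrt (24 * v%:R + 25)) / 2 :> R.
Proof.
have := f_pairs_le v; have := f_le v; move: (f v) => s sv.
(* Writing v as w + s removes truncated subtraction before the passage to [R]. *)
rewrite -[X in Num.sqrt (_ * X%:R + _)](subnK sv) -[X in _ * X%:R + 5](subnK sv).
move: (v - s)%N => w H.
have {}H : 6 * s%:R <= w%:R * (w%:R - 1) :> R.
  (* At w = 0 the natural predecessor is 0 while w - 1 is -1 in [R]; the factor w makes both
     products vanish. *)
  case: w H => [|w]; last first.
    by rewrite -(ler_nat R) !natrM -[w.+1%:R]natr1 /= addrK.
  by rewrite mul0r -(ler_nat R) natrM.
have w0 : 0 <= w%:R :> R by apply: ler0n.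
have : Num.sqrt (24 * (w + s)%:R + 25) <= 2 * w%:R + 5 :> R.
  (* Both sides are nonnegative, so they may be squared; (2 w + 5) ^ 2 - (24 (w + s) + 25) is 4 (w
     (w - 1) - 6 s), nonnegative by [H]. *)
  rewrite -(@ler_pXn2r _ 2) ?nnegrE ?sqrtr_ge0 //; last by lra.
  rewrite sqr_sqrtr ?natrD; first by nra.
  by rewrite -natrD addr_ge0 ?mulr_ge0 ?ler0n.
rewrite natrD; lra.
Qed.
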